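(* Let $b\ge2$, $\ell\ge1$, $m=b^{\ell+1}$. For $\operatorname{Re}(s)>1$, \[ F^{\circ}(s)+\sum_{\substack{p\le m\\ p\nmid b}}\frac{S^{\circ}(p)}{p^{s}}=\sum_{\substack{\chi\bmod m\\ \chi(-1)=-1}}\hat{S}^{\circ}(\chi)\,P(s,\chi),\qquad P(s,\chi)=\sum_{p}\frac{\chi(p)}{p^s}, \] and every character appearing on the right is non-principal; in particular the decomposition of $F^{\circ}$ over characters modulo $m$ contains no term proportional to $\sum_p p^{-s}$ (no Mertens term).
   Context: The collision deviation $S_\ell(p)$ is a real-valued invariant of primes $p$ with $\gcd(p,b)=1$, introduced in a companion paper; it depends only on $p\bmod m$, $m=b^{\ell+1}$, so it is regarded as a function $S$ on $(\mathbb{Z}/m\mathbb{Z})^{\times}$. It satisfies the reflection identity $S(a)+S(m-a)=-1$ for every unit $a$ mod $m$ (established in the companion paper, taken as given). The spectral class of a unit $a$ is $R(a)=(a-1)\bmod b$; $\overline{S}_R$ is the average of $S$ over units with spectral class $R$; the centered collision deviation is $S^{\circ}(a)=S(a)-\overline{S}_{R(a)}$, $S^{\circ}(p)=S^{\circ}(p\bmod m)$, and $\hat{S}^{\circ}(\chi)=\frac{1}{\phi(m)}\sum_a S^{\circ}(a)\overline{\chi}(a)$. Finally $F^{\circ}(s)=\sum_{p>m,\ \gcd(p,b)=1}S^{\circ}(p)p^{-s}$. *)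

(* Defs.v *)
From HB Require Import structures.
From mathcomp Require Import all_boot all_order all_algebra.
From mathcomp Require Import all_classical all_reals all_analysis.
From mathcomp Require Import complex.
Set Implicit Arguments.
Unset Strict Implicit.
Unset Printing Implicit Defensive.
Import Order.TTheory GRing.Theory Num.Theory.
Import numFieldNormedType.Exports.
Local Open Scope ring_scope.
Local Open Scope complex_scope.

(* The standard (modulus) metric topology on R[i], so that complex series can be
   summed with MathComp-Analysis' [cvgn]/[limn]. *)
HB.instance Definition _ (R : rcfType) := PseudoPointedMetric.copy R[i] (R[i])^o.

Definition modulus (b l : nat) : nat := (b ^ l.+1)%N.

Definition is_unit_res (m a : nat) : bool := (a < m)%N && coprime a m.

Definition spec_class (b a : nat) : nat := ((a.-1) %% b)%N.

Section Collision.
Variable R : realType.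

Definition Sbar (b l : nat) (S : nat -> R) (r : nat) : R :=
  let m := modulus b l in
  (\sum_(a < m | is_unit_res m a && (spec_class b a == r)) S a)
  / (#|[pred a : 'I_m | is_unit_res m a && (spec_class b a == r)]|)%:R.

Definition Scirc (b l : nat) (S : nat -> R) (a : nat) : R :=
  S a - Sbar b l S (spec_class b a).

Definition is_dchar (m : nat) (chi : nat -> R[i]) : Prop :=
  [/\ forall n, chi (n + m)%N = chi n,
      forall n1 n2, chi (n1 * n2)%N = chi n1 * chi n2,
      chi 1%N = 1 &
      forall n, chi n = 0 <-> ~~ coprime n m].

Definition principal_dchar (m : nat) : nat -> R[i] :=
  fun n => if coprime n m then 1 else 0.

Definition odd_dchars (m : nat) : set (nat -> R[i]) :=
  [set chi | is_dchar m chi /\ chi (m.-1) = -1].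

Definition Shat (b l : nat) (S : nat -> R) (chi : nat -> R[i]) : R[i] :=
  let m := modulus b l in
  ((totient m)%:R)^-1 *
  \sum_(a < m | is_unit_res m a) (Scirc b l S a)%:C * (chi a)^*.

(* n^{-s} for n >= 1 and complex s = sigma + i t:
   n^{-sigma} (cos (t log n) - i sin (t log n)) *)
Definition npow_neg (n : nat) (s : R[i]) : R[i] :=
  let x : R := n%:R in
  (x `^ (- complex.Re s))%:C *
  ((cos (complex.Im s * ln x))%:C - 'i * (sin (complex.Im s * ln x))%:C).

Definition P_term (chi : nat -> R[i]) (s : R[i]) (n : nat) : R[i] :=
  if prime n then chi n * npow_neg n s else 0.

Definition F_term (b l : nat) (S : nat -> R) (s : R[i]) (n : nat) : R[i] :=
  let m := modulus b l in
  if [&& prime n, (m < n)%N & coprime n b]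
  then (Scirc b l S (n %% m))%:C * npow_neg n s else 0.

Definition small_primes_sum (b l : nat) (S : nat -> R) (s : R[i]) : R[i] :=
  let m := modulus b l in
  \sum_(p < m.+1 | prime p && coprime p b)
     (Scirc b l S (p %% m))%:C * npow_neg p s.

End Collision.

(* Main.v *)
(* The reflection a |-> m - a permutes the spectral classes, so the class
   averages satisfy the same reflection identity as S, and S° = S - Sbar is an
   odd function on the units mod m.  Hence Shat vanishes on even characters, and
   Fourier inversion on (Z/mZ)^* writes S°(p) as a combination of the odd
   characters alone.  Multiplying by p^-s and summing over p gives the identity
   already for the partial sums beyond m; each P(s, chi) converges by comparison
   with the sum of n^-Re(s).

   Orthogonality is derived from the existence of a character separating each
   unit from 1.  Such characters are obtained from the irreducible characters of
   the unit group of 'Z_m, which take their values in the roots of unity of algC,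
   by sending a primitive root of unity of algC to one of R[i] of the same
   order. *)

Require Import Defs.
From HB Require Import structures.
From mathcomp Require Import finmap.
From mathcomp Require Import all_boot all_order all_algebra.
From mathcomp Require Import all_fingroup all_solvable all_field all_character.
From mathcomp Require Import all_classical all_reals all_analysis.
From mathcomp Require Import complex.
From mathcomp Require Import zify ring.
Import Order.TTheory GRing.Theory Num.Theory.
Import numFieldNormedType.Exports.
Local Open Scope ring_scope.
Local Open Scope complex_scope.

Set Implicit Arguments.
Unset Strict Implicit.
Unset Printing Implicit Defensive.

(** * Dirichlet characters *)

(** In characteristic 0 the polynomial X^n - 1 is separable, so it has n distinct roots, and n
    distinct n-th roots of unity in a field include a primitive one. It is applied both to [algC]
    and to [R[i]]. *)
Lemma closed_prim_root_exists (C : numClosedFieldType) n :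
  (n > 0)%N -> exists z : C, n.-primitive_root z.
Proof.
move=> n0; pose p : {poly C} := 'X^n - 1.
have [r Dp] := closed_field_poly_normal p.
rewrite (monicP _) ?monicXnsubC // scale1r in Dp.
have rn1 : all n.-unity_root r by apply/allP=> z; rewrite -root_prod_XsubC -Dp.
have sr : (n < (size r).+1)%N.
  by rewrite -(size_prod_XsubC r id) -Dp size_XnsubC.
have [|z] := hasP (has_prim_root n0 rn1 _ sr); last by exists z.
by rewrite -separable_prod_XsubC -Dp separable_Xn_sub_1 // pnatr_eq0 -lt0n.
Qed.

Section DirichletCharacters.
Variables (R : realType) (m : nat).
Hypothesis m_gt1 : (1 < m)%N.
Implicit Types chi : nat -> R[i].

Let m_gt0 : (0 < m)%N. Proof. exact: ltnW. Qed.

Lemma dchar_mod chi n : is_dchar m chi -> chi (n %% m)%N = chi n.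
Proof.
case=> per _ _ _; rewrite [in RHS](divn_eq n m).
by elim: (n %/ m)%N => [|k IHk]; rewrite ?add0n// mulSn -addnA addnC per.
Qed.

Lemma dchar_notcoprime chi n : is_dchar m chi -> ~~ coprime n m -> chi n = 0.
Proof. by case=> _ _ _ z0 /z0. Qed.

Lemma dcharX chi n k : is_dchar m chi -> chi (n ^ k)%N = chi n ^+ k.
Proof.
case=> _ mul one _; elim: k => [|k IHk]; first by rewrite expn0 expr0.
by rewrite expnS mul IHk exprS.
Qed.

Lemma dchar_eq1 chi n : is_dchar m chi -> n = 1 %[mod m] -> chi n = 1.
Proof.
move=> chiP n1; rewrite -dchar_mod// n1 dchar_mod//.
by case: chiP.
Qed.

Lemma dchar_totient chi n :
  is_dchar m chi -> coprime n m -> chi n ^+ totient m = 1.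
Proof.
move=> chiP nm; rewrite -dcharX//; apply: dchar_eq1 => //.
exact: Euler_exp_totient.
Qed.

Lemma dchar_norm chi n : is_dchar m chi -> coprime n m -> `|chi n| = 1.
Proof.
move=> chiP nm; apply/eqP.
rewrite -(@pexpr_eq1 _ _ (totient m)) ?totient_gt0//.
by rewrite -normrX dchar_totient// normr1.
Qed.

Lemma dchar_conj chi n :
  is_dchar m chi -> coprime n m -> (chi n)^*%R = (chi n)^-1.
Proof. by move=> chiP nm; rewrite invC_norm dchar_norm// expr1n invr1 mul1r. Qed.

Lemma dcharM chi1 chi2 : is_dchar m chi1 -> is_dchar m chi2 ->
  is_dchar m (fun n => chi1 n * chi2 n).
Proof.
move=> [p1 m1 o1 z1] [p2 m2 o2 z2]; split.
- by move=> n; rewrite p1 p2.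
- by move=> n1 n2; rewrite m1 m2 mulrACA.
- by rewrite o1 o2 mulr1.
- move=> n; split; first by move/eqP; rewrite mulf_eq0 => /orP[]/eqP; [move/z1|move/z2].
  by move/z1 => ->; rewrite mul0r.
Qed.

Lemma principal_dcharP : is_dchar m (@principal_dchar R m).
Proof.
rewrite /principal_dchar; split.
- by move=> n; rewrite -coprime_modl modnDr coprime_modl.
- move=> n1 n2; rewrite coprimeMl.
  by do 2 case: coprime; rewrite ?mulr0 ?mul0r ?mulr1.
- by rewrite coprime1n.
- move=> n; case: coprime; split=> // /eqP; by rewrite oner_eq0.
Qed.

Lemma dchar_inv chi : is_dchar m chi -> is_dchar m (fun n => (chi n)^-1).
Proof.
move=> [p1 m1 o1 z1]; split.
- by move=> n; rewrite p1.
- by move=> n1 n2; rewrite m1 invfM.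
- by rewrite o1 invr1.
- move=> n; rewrite -z1; split => [/eqP|->]; last by rewrite invr0.
  by rewrite invr_eq0 => /eqP.
Qed.

Lemma dchar_separates n : coprime n m -> (n %% m != 1)%N ->
  exists2 chi : nat -> R[i], is_dchar m chi & chi n != 1.
Proof.
move=> nm n1; pose gT := {unit 'Z_m}.
pose G := [set: gT]%G.
(* The default value 1 at a [k] not coprime to [m] is harmless: the character built below is 0
   there. *)
pose u k : gT := insubd (1%g : gT) (k%:R : 'Z_m).
have uE k : coprime k m -> val (u k) = k%:R :> 'Z_m.
  by move=> km; rewrite val_insubd unitZpE// coprime_sym km.
have uM k1 k2 : coprime k1 m -> coprime k2 m -> u (k1 * k2)%N = (u k1 * u k2)%g.
  move=> c1 c2; apply: val_inj; rewrite uE ?coprimeMl ?c1// natrM.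
  by rewrite -(uE _ c1) -(uE _ c2).
have uD k : u (k + m)%N = u k by rewrite /u natrD pchar_Zp ?addr0.
have u1 : u 1%N = 1%g by apply: val_inj; rewrite uE ?coprime1n.
have abG : abelian G by apply/centsP=> x _ y _; exact: unit_Zp_mulgC.
have un : u n != 1%g.
  apply: contra n1 => /eqP/(congr1 val); rewrite uE// => /(congr1 val).
  by rewrite /= val_Zp_nat// => ->; rewrite /= Zp_cast// modn_small.
(* The kernels of all irreducible characters meet trivially. As the group is abelian, these
   characters are linear, and lying in a kernel means taking the value 1. *)
have [i chin] : exists i : Iirr G, 'chi_i (u n) != 1.
  apply/existsP; apply: contraR un => /existsPn ichi.
  have : u n \in \bigcap_i cfker 'chi[G]_i.
    apply/bigcapP => i _; rewrite cfkerEirr inE lin_char1; last exact/char_abelianP.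
    by have := ichi i; rewrite negbK.
  by rewrite TI_cfker_irr inE.
have lin : 'chi_i \is a linear_char by exact/char_abelianP.
have e0 : (0 < #|G|)%N by exact: cardG_gt0.
have [w pw] := @closed_prim_root_exists algC _ e0.
have [z pz] := @closed_prim_root_exists R[i] _ e0.
have root x : 'chi_i x ^+ #|G| = 1.
  by rewrite -lin_charX ?inE// expg_cardG ?inE// lin_char1.
(* [k] is a discrete logarithm to base [w]. Powers of [w] and of [z] agree under the same congruence
   of exponents modulo [#|G|], so every identity between values of ['chi_i] carries over to
   [z ^+ k x]. *)
pose k x := sval (prim_rootP pw (root x)).
have kE x : 'chi_i x = w ^+ k x by exact: (svalP (prim_rootP pw (root x))).
pose chi p : R[i] := if coprime p m then z ^+ k (u p) else 0.
exists chi; last first.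
  rewrite /chi nm; apply: contra chin.
  by rewrite kE -(expr0 z) -(expr0 w) !(eq_prim_root_expr pz, eq_prim_root_expr pw).
rewrite /chi; split.
- by move=> p; rewrite uD -coprime_modl modnDr coprime_modl.
- move=> p1 p2; rewrite coprimeMl.
  have [c1|_] := boolP (coprime p1 m); last by rewrite mul0r.
  have [c2|_] := boolP (coprime p2 m); last by rewrite mulr0.
  apply/eqP; rewrite -exprD (eq_prim_root_expr pz) -(eq_prim_root_expr pw).
  by rewrite exprD -!kE uM// lin_charM ?inE.
- apply/eqP; rewrite coprime1n u1 -(expr0 z) (eq_prim_root_expr pz).
  by rewrite -(eq_prim_root_expr pw) -kE lin_char1.
- move=> p; case: coprime; split => // /eqP.
  rewrite expf_eq0 => /andP[_ /eqP z0]; have := prim_expr_order pz.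
  by rewrite z0 expr0n gtn_eqF// => /eqP; rewrite eq_sym oner_eq0.
Qed.

Definition dchars : set (nat -> R[i]) := [set chi | is_dchar m chi].

Lemma finite_dchars : finite_set dchars.
Proof.
have e0 : (0 < totient m)%N by rewrite totient_gt0.
have [z pz] := @closed_prim_root_exists R[i] _ e0.
(* A character is determined by its values on residues, each either 0 (coded by [None]) or one of
   the [totient m] powers of [z]. *)
pose F (f : {ffun 'I_m -> option 'I_(totient m)}) (n : nat) : R[i] :=
  if f (Ordinal (ltn_pmod n m_gt0)) is Some k then z ^+ k else 0.
apply: (@sub_finite_set _ _ (F @` setT)); last exact/finite_image/finite_finset.
move=> chi chiP.
pose f := [ffun i : 'I_m => [pick k : 'I_(totient m) | chi i == z ^+ k]].
exists f => //; apply/funext => n; rewrite /F ffunE /=.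
case: pickP => [k|nok]; first by rewrite dchar_mod// => /eqP.
have [nm|nm] := boolP (coprime n m); last exact/esym/dchar_notcoprime.
have [k chik] := prim_rootP pz (dchar_totient chiP nm).
by have := nok k; rewrite dchar_mod// chik eqxx.
Qed.

(** Multiplication by a character [psi] with [psi n] different from 1 permutes the characters and
    multiplies the sum by [psi n], so the sum vanishes. *)
Lemma sum_dchars_eq0 n : coprime n m -> (n %% m != 1)%N ->
  (\sum_(chi \in dchars) chi n = 0)%R.
Proof.
move=> nm n1; have [psi psiP psin] := dchar_separates nm n1.
have psi_bij : set_bij dchars dchars (fun chi k => psi k * chi k).
  have psi0 k : coprime k m -> psi k != 0.
    by move=> km; apply/eqP; case: psiP => _ _ _ ->; rewrite km.
  have chi0 (chi : nat -> R[i]) k : dchars chi -> ~~ coprime k m -> chi k = 0.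
    by case=> _ _ _ z0 /z0.
  split=> [chi|chi1 chi2 /set_mem h1 /set_mem h2 eq12|chi chiP].
  - exact: dcharM.
  - apply/funext => k; have [km|km] := boolP (coprime k m).
      by apply: (mulfI (psi0 k km)); move/(congr1 (fun f => f k)): eq12.
    by rewrite (chi0 chi1)// (chi0 chi2).
  - exists (fun k => (psi k)^-1 * chi k); first exact: dcharM (dchar_inv psiP) chiP.
    apply/funext => k; have [km|km] := boolP (coprime k m).
      by rewrite mulrA divff ?mul1r ?psi0.
    by rewrite (chi0 chi)// !mulr0.
set s := (LHS); have : s = psi n * s.
  rewrite {1}/s (reindex_fsbig _ _ _ _ psi_bij) /s !fsbig_finite//; try exact: finite_dchars.
  by rewrite mulr_sumr.
move/eqP; rewrite -[eqbLHS]mul1r -subr_eq0 -mulrBl mulf_eq0 subr_eq0 eq_sym.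
by rewrite (negPf psin) => /eqP.
Qed.

(** Dual argument: if [chi a] differs from 1 for some unit [a], multiplication by [a] permutes the
    residues and scales the sum by [chi a]. *)
Lemma sum_dchar_residues chi : is_dchar m chi ->
  \sum_(a < m) chi a = if chi == @principal_dchar R m then (totient m)%:R else 0.
Proof.
move=> chiP; case: ifPn => [/eqP ->|/eqP chi1].
  rewrite totient_count_coprime natr_sum big_mkord; apply: eq_bigr => a _.
  by rewrite /principal_dchar coprime_sym; case: coprime.
have [a am chia] : exists2 a, coprime a m & chi a != 1.
  apply: contrapT => h; apply: chi1; apply/funext => a.
  rewrite /principal_dchar; case: ifPn => [am|am]; last exact: dchar_notcoprime.
  by apply/eqP; apply: contrapT => /negP chia; apply: h; exists a.
pose h (x : 'I_m) := Ordinal (ltn_pmod (a * x) m_gt0).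
have h_inj : injective h.
  move=> x y /(congr1 val)/= axy; apply: val_inj => /=.
  have t0 : (0 < totient m)%N by rewrite totient_gt0.
  (* By Euler's theorem [a ^ (totient m).-1] is an inverse of [a] modulo [m]. *)
  have mulVa z : a ^ (totient m).-1 * (a * z) = z %[mod m].
    by rewrite mulnA -expnSr prednK// -modnMml Euler_exp_totient// modnMml mul1n.
  rewrite -(modn_small (ltn_ord x)) -(modn_small (ltn_ord y)).
  by rewrite -(mulVa x) -(mulVa y) -modnMmr axy modnMmr.
set s := (LHS); have : s = chi a * s.
  rewrite {1}/s (reindex_inj h_inj) mulr_sumr; apply: eq_bigr => x _ /=.
  by rewrite dchar_mod//; case: chiP => _ -> .
move/eqP; rewrite -[eqbLHS]mul1r -subr_eq0 -mulrBl mulf_eq0 subr_eq0 eq_sym.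
by rewrite (negPf chia) => /eqP.
Qed.

(** Counts the characters by summing [chi a] over all pairs in two ways: for fixed [a] only the
    residue 1 contributes, for fixed [chi] only the principal character does, with [totient m]. *)
Lemma sum_dchars_eq1 n : n = 1 %[mod m] ->
  (\sum_(chi \in dchars) chi n = (totient m)%:R)%R.
Proof.
move=> n1; have fD := finite_dchars.
transitivity (\sum_(a < m) \sum_(chi <- fset_set dchars) chi a).
  rewrite (bigD1 (Ordinal m_gt1))//= [X in _ + X]big1 ?addr0 => [|a a1].
    rewrite fsbig_finite//; apply: eq_big_seq => chi.
    by rewrite in_fset_set// => /set_mem chiP; rewrite dchar_eq1//; case: chiP.
  have [am|am] := boolP (coprime a m).
    by rewrite -fsbig_finite// sum_dchars_eq0// modn_small.
  rewrite big_seq big1// => chi; rewrite in_fset_set// => /set_mem chiP.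
  exact: dchar_notcoprime.
rewrite exchange_big/=.
transitivity (\sum_(chi <- fset_set dchars)
    if chi == @principal_dchar R m then (totient m)%:R else 0 : R[i]).
  apply: eq_big_seq => chi; rewrite in_fset_set// => /set_mem chiP.
  exact: sum_dchar_residues.
rewrite (big_fsetD1 (@principal_dchar R m))/=; last first.
  by rewrite in_fset_set// mem_set//; exact: principal_dcharP.
rewrite eqxx big1_fset ?addr0// => chi.
by rewrite in_fsetD1 => /andP[/negPf ->].
Qed.

(** After exchanging the sums, the conjugate of [chi x] times [chi a] is [chi] at the quotient of
    [a] by [x], and orthogonality leaves only the term at [x = a]. *)
Lemma dchar_inversion (f : nat -> R[i]) a : (a < m)%N -> coprime a m ->
  (\sum_(chi \in dchars)
    ((totient m)%:R^-1 * \sum_(x < m | is_unit_res m x) f x * (chi x)^*) * chi a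
   = f a)%R.
Proof.
move=> am ca; have fD := finite_dchars.
have e0 : (totient m)%:R != 0 :> R[i] by rewrite pnatr_eq0 -lt0n totient_gt0.
rewrite fsbig_finite//=.
under eq_bigr do rewrite -mulrA mulr_suml mulr_sumr.
rewrite exchange_big/= (bigD1 (Ordinal am)) /=; last by rewrite /is_unit_res am.
have inner x : (x < m)%N -> coprime x m ->
    \sum_(chi <- fset_set dchars) (totient m)%:R^-1 * (f x * (chi x)^* * chi a) =
    if x == a then f a else 0.
  move=> xm cx; have t0 : (0 < totient m)%N by rewrite totient_gt0.
  rewrite -mulr_sumr.
  transitivity ((totient m)%:R^-1 * (f x *
     \sum_(chi <- fset_set dchars) chi (x ^ (totient m).-1 * a)%N)).
    congr (_ * _); rewrite mulr_sumr; apply: eq_big_seq => chi.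
    rewrite in_fset_set// => /set_mem chiP; rewrite -mulrA; congr (_ * _).
    have [_ -> _ _] := chiP; congr (_ * _); rewrite dchar_conj// dcharX//.
    have chix0 : chi x != 0 by apply/eqP; case: chiP => _ _ _ ->; rewrite cx.
    by apply: (mulfI chix0); rewrite divff// -exprS prednK// dchar_totient.
  have cxa : coprime (x ^ (totient m).-1 * a) m by rewrite coprimeMl ca coprimeXl.
  rewrite -fsbig_finite//; case: eqP => [->|xa].
    rewrite sum_dchars_eq1; first by rewrite mulrCA mulVf// mulr1.
    by rewrite -expnSr prednK// Euler_exp_totient.
  rewrite sum_dchars_eq0 ?mulr0//; apply/eqP => h; apply: xa.
  (* Multiplying by [x] turns a quotient congruent to 1 back into [a = x] modulo [m]. *)
  have : x * (x ^ (totient m).-1 * a) = x * 1 %[mod m].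
    by apply/eqP; rewrite -modnMmr h.
  rewrite mulnA -expnS prednK// -modnMml Euler_exp_totient// modnMml mul1n muln1.
  by rewrite !modn_small.
rewrite inner// eqxx big1 ?addr0// => x /andP[/andP[xm cx] xa].
by rewrite inner// ifF//; apply: contraNF xa => /eqP xa; apply/eqP/val_inj.
Qed.
End DirichletCharacters.
 

(** * Reflection symmetry of the collision deviation *)

Section Reflection.
Variables (R : realType) (b l : nat) (S : nat -> R).
Let m := modulus b l.
Hypothesis m_gt1 : (1 < m)%N.
Let m_gt0 : (0 < m)%N. Proof. exact: ltnW. Qed.

Lemma unit_res_gt0 a : is_unit_res m a -> (0 < a)%N.
Proof.
by case: a => //; rewrite /is_unit_res /coprime gcd0n => /andP[_ /eqP m1]; move: m_gt1; rewrite m1.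
Qed.

Lemma unit_res_reflect a : is_unit_res m a -> is_unit_res m (m - a).
Proof.
move=> ua; have a0 := unit_res_gt0 ua; case/andP: ua => am ca.
rewrite /is_unit_res ltn_subrL a0 m_gt0 /=.
have em : m = (m - a + a)%N by rewrite subnK// ltnW.
by move: ca; rewrite /coprime {1}em gcdnDr {3}em gcdnDl gcdnC.
Qed.

(** The sum of [(m - x).-1] and [x.-1] is [m - 2] whatever [x] is, so two residues agree modulo [b]
    after reflection exactly when they did before. *)
Lemma spec_class_reflect x a : (0 < x < m)%N -> (0 < a < m)%N ->
  (spec_class b (m - x) == spec_class b (m - a)) = (spec_class b x == spec_class b a).
Proof.
move=> xm am; rewrite /spec_class -(eqn_modDr x.-1).
have -> : ((m - x).-1 + x.-1 = (m - a).-1 + a.-1)%N by lia.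
by rewrite eqn_modDl eq_sym.
Qed.

(** The reduction modulo [m] matters only at 0, which becomes a fixed point; this makes the
    reflection an involution of all of ['I_m]. *)
Let refl (x : 'I_m) : 'I_m := Ordinal (ltn_pmod (m - x) m_gt0).

Let reflK : involutive refl.
Proof.
move=> x; apply: val_inj => /=; have xm := ltn_ord x.
have [->|x0] := posnP (x : nat); first by rewrite subn0 modnn subn0 modnn.
rewrite [((m - x) %% m)%N]modn_small; last by rewrite ltn_subrL x0.
by rewrite subKn ?modn_small// ltnW.
Qed.

Let unit_refl (x : 'I_m) : is_unit_res m x -> refl x = (m - x)%N :> nat.
Proof.
move=> ux; rewrite /= modn_small// ltn_subrL m_gt0 andbT.
exact: unit_res_gt0 ux.
Qed.

Let is_unit_refl (x : 'I_m) : is_unit_res m (refl x) = is_unit_res m x.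
Proof.
have h (y : 'I_m) : is_unit_res m y -> is_unit_res m (refl y).
  by move=> uy; rewrite unit_refl//; exact: unit_res_reflect.
by apply/idP/idP => [/h|/h//]; rewrite reflK.
Qed.

Lemma reindex_units (T : Type) (idx : T) (op : Monoid.com_law idx)
    (P : pred nat) (F : nat -> T) :
  \big[op/idx]_(x < m | is_unit_res m x && P x) F x =
  \big[op/idx]_(x < m | is_unit_res m x && P (m - x)%N) F (m - x)%N.
Proof.
rewrite (reindex_inj (inv_inj reflK)).
apply: eq_big => [x|x /andP[]]; rewrite is_unit_refl.
  by case: (boolP (is_unit_res m x)) => // ux; rewrite (unit_refl ux).
by move=> ux _; rewrite (unit_refl ux).
Qed.

Hypothesis S_reflect : forall a, is_unit_res m a -> S a + S (m - a)%N = -1.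

(** Reflection maps the units in the class of [a] bijectively onto those in the class of [m - a]:
    both averages have the same denominator, and each summand [S x] becomes [-1 - S x]. *)
Lemma Sbar_reflect a : is_unit_res m a ->
  Sbar b l S (spec_class b (m - a)) = - 1 - Sbar b l S (spec_class b a).
Proof.
move=> ua; rewrite /Sbar -/m.
have unitP x : is_unit_res m x -> (0 < x < m)%N.
  by move=> ux; rewrite (unit_res_gt0 ux); case/andP: ux.
have specP x : is_unit_res m x && (spec_class b (m - x) == spec_class b (m - a)) =
             is_unit_res m x && (spec_class b x == spec_class b a).
  by case: (boolP (is_unit_res m x)) => //= ux; rewrite spec_class_reflect ?unitP.
rewrite -!sum1_card !natr_sum.
rewrite (reindex_units _ (fun x => spec_class b x == spec_class b (m - a)) S).
rewrite (reindex_units _ (fun x => spec_class b x == spec_class b (m - a)) (fun=> 1)).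
under [X in X / _ = _]eq_bigl do rewrite /= specP.
under [X in _ / X = _]eq_bigl do rewrite /= specP.
set P := fun x : 'I_m => is_unit_res m x && _.
(* The class contains [a] itself, so the average of the constant -1 is indeed -1. *)
have N0 : \sum_(x | P x) (1 : R) != 0.
  rewrite sumr_const pnatr_eq0 -lt0n; apply/card_gt0P.
  have am : (a < m)%N by case/andP: ua.
  by exists (Ordinal am); rewrite unfold_in /P /= ua eqxx.
have -> : \sum_(x | P x) S (m - x)%N = \sum_(x | P x) (-1 - S x).
  by apply: eq_bigr => x /andP[ux _]; rewrite -(S_reflect ux) addrAC subrr add0r.
rewrite sumrB mulrBl; congr (_ - _).
by rewrite sumrN mulNr divff.
Qed.

(** The constant -1 occurs in the reflection of [S] and in that of its class average, and cancels in
    the difference. *)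
Lemma Scirc_reflect a : is_unit_res m a -> Scirc b l S (m - a)%N = - Scirc b l S a.
Proof.
move=> ua; rewrite /Scirc Sbar_reflect// -(S_reflect ua).
by rewrite !opprB !opprD; ring.
Qed.

Lemma dchar_reflect (chi : nat -> R[i]) a : is_dchar m chi -> (a <= m)%N ->
  chi (m - a)%N = chi m.-1 * chi a.
Proof.
move=> chiP am; have [_ mul _ _] := chiP.
rewrite -mul -(dchar_mod (m.-1 * a) chiP) -(dchar_mod (m - a) chiP).
congr chi; apply/eqP; rewrite -(eqn_modDr a) subnK//.
by rewrite -mulSnr prednK// modnn modnMr.
Qed.

Lemma dchar_even_or_odd (chi : nat -> R[i]) : is_dchar m chi ->
  chi m.-1 = 1 \/ chi m.-1 = -1.
Proof.
move=> chiP; have : chi m.-1 ^+ 2 = 1.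
  have [_ _ one _] := chiP; rewrite expr2 -dchar_reflect ?leq_pred//.
  by rewrite -subn1 subKn.
by move/eqP; rewrite sqrf_eq1 => /orP[]/eqP; [left|right].
Qed.

(** For even [chi] the summand changes sign under reflection, so the sum equals its own negative. *)
Lemma Shat_even (chi : nat -> R[i]) : is_dchar m chi -> chi m.-1 = 1 ->
  Shat b l S chi = 0.
Proof.
move=> chiP chi1; rewrite /Shat -/m; set s := (X in _ * X).
suff : s = - s.
  by move/eqP; rewrite -subr_eq0 opprK -mulr2n mulrn_eq0/= => /eqP ->; rewrite mulr0.
have big_unit (F : nat -> R[i]) : \sum_(x < m | is_unit_res m x) F x =
    \sum_(x < m | is_unit_res m x && predT (x : nat)) F x.
  by apply: eq_bigl => x; rewrite andbT.
pose F (a : nat) : R[i] := (Scirc b l S a)%:C * (chi a)^*%R.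
rewrite {1}/s (big_unit F) (reindex_units _ predT F).
rewrite -sumrN; apply: eq_big => [x|x /andP[ux _]]; first by rewrite andbT.
rewrite /F.
rewrite Scirc_reflect// dchar_reflect ?chi1 ?mul1r//; last by case/andP: ux => /ltnW.
by rewrite rmorphN mulNr.
Qed.
End Reflection.

(** * Convergence *)

Local Open Scope classical_set_scope.

Lemma cvg_series_powRN (R : realType) (x : R) : 1 < x ->
  cvgn (series (fun n : nat => n%:R `^ (- x))).
Proof.
move=> x1; set a := fun n : nat => _.
have a0 n : 0 <= a n by exact: powR_ge0.
have am i j : (0 < i)%N -> (i <= j)%N -> a j <= a i.
  move=> i0 ij; have j0 := leq_trans i0 ij.
  rewrite /a !powRN lef_pV2 ?posrE ?powR_gt0 ?ltr0n//.
  by rewrite ge0_ler_powR ?nnegrE ?ler0n ?ler_nat// (le_trans ler01)// ltW.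
(* The block of indices from [2 ^ k] to [2 ^ k.+1] has [2 ^ k] terms, each at most its first one,
   hence total at most [q ^+ k]. *)
pose q : R := 2 `^ (1 - x).
have q0 : 0 <= q by exact: powR_ge0.
have q1 : q < 1.
  rewrite /q -opprB powRN invf_lt1 ?powR_gt0//.
  apply: (@le_lt_trans _ _ (1 `^ (x - 1))); first by rewrite powR1.
  by rewrite gt0_ltr_powR ?nnegrE ?subr_gt0 ?ler0n ?ltr1n.
(* Cauchy condensation. *)
have dyadic k : \sum_(0 <= n < 2 ^ k) a n <= \sum_(0 <= j < k) q ^+ j.
  elim: k => [|k IHk].
    (* The term at index 0 is 0, because 0 raised to a nonzero exponent is 0. *)
    by rewrite expn0 big_nat1 big_geq// /a powR0// oppr_eq0 gt_eqF// (lt_trans ltr01).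
  rewrite (@big_cat_nat _ _ _ (2 ^ k)%N)//= ?leq_exp2l// big_nat_recr//= lerD//.
  apply: (@le_trans _ _ (\sum_(2 ^ k <= n < 2 ^ k.+1) a (2 ^ k)%N)).
    by apply: ler_sum_nat => i /andP[ki _]; rewrite am ?expn_gt0.
  rewrite sumr_const_nat expnS mul2n -addnn addnK -mulr_natr /a natrX.
  rewrite -powR_mulrn// -powRrM mulrN -mulNr mulrC -powRD; last first.
    by rewrite pnatr_eq0 implybT.
  by rewrite mulNr -{1}[k%:R]mulr1 -mulrN -mulrDr mulrC powRrM powR_mulrn.
apply: nondecreasing_is_cvgn.
  by apply/nondecreasing_seqP => n; rewrite /series /= big_nat_recr//= lerDl.
exists (1 - q)^-1 => _ [n _ <-].
apply: (@le_trans _ _ (series a (2 ^ n)%N)).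
  rewrite /series/= (@big_cat_nat _ _ _ n 0 (2 ^ n))//= ?(ltnW (ltn_expl _ _))//.
  by rewrite lerDl sumr_ge0.
apply: le_trans (dyadic n) _.
rewrite -[leRHS]mul1r ler_pdivlMr ?subr_gt0// big_mkord mulr_suml.
have -> : \sum_(i < n) q ^+ i * (1 - q) = 1 - q ^+ n.
  by rewrite -[RHS]opprB subrX1 -mulr_suml -mulNr opprB mulrC.
by rewrite lerBlDr lerDl exprn_ge0.
Qed.

Lemma cvg_complex (R : realType) (u : nat -> R[i]) (a : R[i]) :
  complex.Re (u n) @[n --> \oo] --> complex.Re a ->
  complex.Im (u n) @[n --> \oo] --> complex.Im a ->
  u @ \oo --> a.
Proof.
move=> /cvgrPdist_le uR /cvgrPdist_le uI.
apply: (iffRL (@cvgrPdist_le _ (R[i])^o _ _ _ u a)) => e e0.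
(* A positive element of [R[i]] is real, so half of its real part can be allotted to each
   coordinate. *)
have [e1 e2] : complex.Im e = 0 /\ 0 < complex.Re e.
  by move: e0; rewrite ltcE /= => /andP[/eqP ? ?].
have h : 0 < complex.Re e / 2 by rewrite divr_gt0.
near=> n.
have -> : e = (complex.Re e)%:C by rewrite {1}[e]complexE e1 mulr0 addr0.
rewrite [X in `|X|]complexE [complex.Re e]splitr [leRHS]raddfD/=.
apply: (le_trans (ler_normD _ _)).
apply: lerD.
  rewrite normc_def /= expr0n addr0 sqrtr_sqr lecR.
  by rewrite raddfB/=; near: n; exact: uR.
rewrite normrM !normc_def /= !expr0n !addr0 add0r expr1n sqrtr1 mul1r sqrtr_sqr lecR.
by rewrite raddfB/=; near: n; exact: uI.
Unshelve. all: by end_near. Qed.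

Lemma Re_series (R : realType) (u : nat -> R[i]) n :
  complex.Re (series u n) = series (fun k => complex.Re (u k)) n.
Proof. by rewrite /series /= raddf_sum. Qed.

Lemma Im_series (R : realType) (u : nat -> R[i]) n :
  complex.Im (series u n) = series (fun k => complex.Im (u k)) n.
Proof. by rewrite /series /= raddf_sum. Qed.

(** Real and imaginary parts are bounded by the modulus, so real comparison with [v] applies to each
    coordinate. *)
Lemma cvg_series_dominated (R : realType) (u : nat -> R[i]) (v : nat -> R) :
  (forall n, `|u n| <= (v n)%:C) -> cvgn (series v) -> cvgn (series u).
Proof.
move=> uv cv.
have v0 n : 0 <= v n by rewrite -ler0c (le_trans _ (uv n)).
have dom (w : nat -> R) : (forall n, `|w n| <= v n) -> cvgn (series w).
  move=> wv; apply: normed_cvg; apply: series_le_cvg cv => //.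
  by move=> n; exact: normr_ge0.
have cR : cvgn (series (fun k => complex.Re (u k))).
  apply: dom => n; rewrite -lecR; apply: le_trans (uv n); exact: normc_ge_Re.
have cI : cvgn (series (fun k => complex.Im (u k))).
  apply: dom => n; rewrite -lecR; apply: le_trans (uv n).
  by rewrite normc_def lecR -sqrtr_sqr ler_wsqrtr// lerDr sqr_ge0.
apply: (cvgP (Complex (limn (series (fun k => complex.Re (u k))))
                      (limn (series (fun k => complex.Im (u k)))))).
apply: cvg_complex => /=.
  by under eq_fun do rewrite Re_series.
by under eq_fun do rewrite Im_series.
Qed.

Lemma normc_npow_neg (R : realType) n (s : R[i]) :
  `|npow_neg n s| = (n%:R `^ (- complex.Re s))%:C.
Proof.
rewrite /npow_neg normrM; set p := _ `^ _; set t := _ * ln _.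
rewrite !normc_def /= expr0n addr0 sqrtr_sqr ger0_norm ?powR_ge0//.
rewrite !(mul0r, mulr0, mul1r, subr0, sub0r, addr0, add0r, oppr0).
by rewrite sqrrN cos2Dsin2 sqrtr1 mulr1.
Qed.

Lemma cvg_lincomb (R : realType) (I : eqType) (r : seq I) (c : I -> R[i])
    (u : I -> nat -> R[i]) (a : I -> R[i]) :
  (forall i, i \in r -> u i @ \oo --> a i) ->
  (fun n => \sum_(i <- r) c i * u i n) @ \oo --> \sum_(i <- r) c i * a i.
Proof.
elim: r => [|i r IHr] h.
  under eq_fun do rewrite big_nil.
  by rewrite big_nil; exact: (@cvg_cst (R[i])^o).
under eq_fun do rewrite big_cons.
rewrite big_cons; apply: (@cvgD _ (R[i])^o).
  by apply: (@cvgZr _ (R[i])^o); apply: h; rewrite mem_head.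
by apply: IHr => j jr; apply: h; rewrite inE jr orbT.
Qed.

Lemma cvg_P_term (R : realType) m (chi : nat -> R[i]) (s : R[i]) :
  (1 < m)%N -> is_dchar m chi -> 1 < complex.Re s ->
  cvgn (series (P_term chi s)).
Proof.
move=> m1 chiP s1; apply: (cvg_series_dominated _ (cvg_series_powRN s1)) => n.
rewrite -normc_npow_neg /P_term; case: ifP => _; last by rewrite normr0 normr_ge0.
rewrite normrM; have [nm|nm] := boolP (coprime n m).
  by rewrite (dchar_norm m1)// mul1r.
by rewrite (dchar_notcoprime chiP)// normr0 mul0r normr_ge0.
Qed.

Lemma finite_odd_dchars (R : realType) m :
  (1 < m)%N -> finite_set (@odd_dchars R m).
Proof. by move=> m1; apply: sub_finite_set (finite_dchars R m1) => chi []. Qed.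

(** * Expansion over odd characters *)

Section Decomposition.
Variables (R : realType) (b l : nat) (S : nat -> R) (s : R[i]).
Let m := modulus b l.
Hypothesis m_gt1 : (1 < m)%N.
Hypothesis S_reflect : forall a, is_unit_res m a -> S a + S (m - a)%N = -1.

Lemma Scirc_odd_expansion n : coprime n m ->
  ((Scirc b l S (n %% m))%:C =
   \sum_(chi <- fset_set (@odd_dchars R m)) Shat b l S chi * chi n)%R.
Proof.
move=> nm; have nm1 : (n %% m < m)%N by rewrite ltn_pmod// ltnW.
have nm2 : coprime (n %% m) m by rewrite coprime_modl.
rewrite -(dchar_inversion m_gt1 (fun a => (Scirc b l S a)%:C) nm1 nm2).
rewrite -fsbig_finite; last exact: finite_odd_dchars.
transitivity (\sum_(chi \in @dchars R m) Shat b l S chi * chi n)%R.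
  by apply: eq_fsbigr => chi /set_mem chiP; rewrite dchar_mod.
(* The characters dropped from the sum are those that are not odd; they are even, so their
   coefficient is 0. *)
apply/esym/fsbig_widen; first by move=> chi [].
move=> chi [chiP nodd] /=; rewrite (Shat_even m_gt1)// ?mul0r//.
by have [//|chi1] := dchar_even_or_odd m_gt1 chiP; case: nodd.
Qed.

(** The common summand: [small_primes_sum] is its sum up to [m], and [F_term] is its restriction
    beyond [m]. *)
Let G n : R[i] :=
  if prime n && coprime n b then (Scirc b l S (n %% m))%:C * npow_neg n s else 0.

Lemma sum_F_term N : (m < N)%N ->
  series (F_term b l S s) N + small_primes_sum b l S s =
  \sum_(chi <- fset_set (@odd_dchars R m)) Shat b l S chi * series (P_term chi s) N.
Proof.
move=> mN.
have -> : small_primes_sum b l S s = \sum_(0 <= n < m.+1) G n.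
  by rewrite big_mkord /small_primes_sum big_mkcond.
have -> : series (F_term b l S s) N = \sum_(m.+1 <= n < N) G n.
  rewrite /series/= (@big_cat_nat _ _ _ m.+1)//= big_nat big1 ?add0r => [|n /andP[_ nm]].
    rewrite big_nat [RHS]big_nat; apply: eq_bigr => n /andP[mn _].
    by rewrite /F_term /G -/m mn.
  by rewrite /F_term -/m ltnNge -ltnS nm andbF.
rewrite addrC -big_cat_nat//=.
under [RHS]eq_bigr do rewrite /series/= mulr_sumr.
rewrite exchange_big/=; apply: eq_bigr => n _.
rewrite /G /P_term; case: (prime n) => /=; last by rewrite big1// => chi _; rewrite mulr0.
(* As [m] is a positive power of [b], the primes dividing [b], left out on one side, are exactly
   those where every character vanishes. *)
have -> : coprime n b = coprime n m by rewrite coprime_pexpr.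
case: ifPn => [nm|nm]; last first.
  rewrite big_seq big1// => chi; rewrite in_fset_set; last exact: finite_odd_dchars.
  by move=> /set_mem[chiP _]; rewrite (dchar_notcoprime chiP)// mul0r mulr0.
by rewrite Scirc_odd_expansion// mulr_suml; apply: eq_bigr => chi _; rewrite mulrA.
Qed.

Lemma cvg_F_term : 1 < complex.Re s ->
  series (F_term b l S s) @ \oo -->
  \sum_(chi <- fset_set (@odd_dchars R m)) Shat b l S chi * limn (series (P_term chi s))
  - small_primes_sum b l S s.
Proof.
move=> s1.
apply: (@cvg_trans _ ((fun N => \sum_(chi <- fset_set (@odd_dchars R m))
    Shat b l S chi * series (P_term chi s) N - small_primes_sum b l S s) @ \oo)).
  (* The finite identity needs [N] beyond [m], which suffices for the limit. *)
  apply: near_eq_cvg; exists m.+1 => // N /= mN.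
  by rewrite -sum_F_term// addrK.
apply: (@cvgB _ (R[i])^o); last exact: (@cvg_cst (R[i])^o).
apply: cvg_lincomb => chi; rewrite in_fset_set; last exact: finite_odd_dchars.
by move=> /set_mem[chiP _]; exact: cvg_P_term m_gt1 chiP s1.
Qed.
End Decomposition.

Local Close Scope classical_set_scope.

Theorem mainTheorem8 (R : realType) (b l : nat) (S : nat -> R) (s : R[i]) :
  (2 <= b)%N -> (1 <= l)%N ->
  (* reflection identity S(a) + S(m - a) = -1 for every unit a mod m *)
  (forall a : nat, is_unit_res (modulus b l) a ->
     S a + S (modulus b l - a)%N = -1) ->
  1 < complex.Re s ->
  [/\ cvgn (series (F_term b l S s)),
      (forall chi, @odd_dchars R (modulus b l) chi -> cvgn (series (P_term chi s))),
      limn (series (F_term b l S s)) + small_primes_sum b l S s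
        = (\sum_(chi \in @odd_dchars R (modulus b l))
             Shat b l S chi * limn (series (P_term chi s)))%R &
      forall chi, @odd_dchars R (modulus b l) chi ->
        chi <> @principal_dchar R (modulus b l)].
Proof.
move=> b2 _ S_reflect s1.
have m1 : (1 < modulus b l)%N by rewrite -(exp1n l.+1) ltn_exp2r.
have cF := cvg_F_term m1 S_reflect s1.
split.
- exact: cvgP cF.
- by move=> chi [chiP _]; exact: cvg_P_term m1 chiP s1.
- rewrite fsbig_finite; last exact: finite_odd_dchars.
  by rewrite (@cvg_lim _ _ _ _ _ _ _ cF) ?subrK//; exact: (@norm_hausdorff _ (R[i])^o).
(* Since [m - 1] is coprime to [m], the principal character is 1 there, whereas an odd one is -1. *)
- move=> chi [_ chi1] chiE; move: chi1.
  rewrite chiE /principal_dchar coprimePn ?(ltnW m1)// => /eqP.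
  by rewrite eq_sym eqNr oner_eq0.
Qed.
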